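(* Let a compact metric group $G$ act continuously on a doubling space $X$ and let $x\in X$. Assume that a positive number $r_0$ (for which $C(r_0,5r_0)$ is defined) satisfies $$r_0>\max\Big\{\omega_x\Big(+\operatorname{Sep}\Big(G;\kappa,\frac{1}{C(r_0,5r_0)}\Big)\Big),\ \omega_x\Big(+\operatorname{Sep}\Big(G;\frac{1-\kappa}{3},\frac{1-\kappa}{3}\Big)\Big),\ \omega_x\Big(+\operatorname{Sep}\Big(G;\frac{1-\kappa}{3},\kappa\Big)\Big)\Big\}$$ for some $\kappa\in(0,1/2)$. Then there exists a point $z_{x,\kappa}\in X$ such that $$d_X(z_{x,\kappa},gz_{x,\kappa})\leq 3r_0+\rho(3r_0)$$ for any $g\in G$. Moreover, there exists a point $z'_{x,\kappa}\in Gx$ such that $$d_X(z'_{x,\kappa},gz'_{x,\kappa})\leq\min\{6r_0+\rho(6r_0),\ 6r_0+2\rho(3r_0)\}$$ for any $g\in G$.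
   Context: A complete metric space $X$ is a doubling space if there exist $R_1>0$ and a function $D:(0,R_1]\to(0,+\infty)$ such that every closed ball of radius $2r_1\leq 2R_1$ is covered by at most $D(r_1)$ closed balls of radius $r_1$. Equivalently, there is a function $C=C_X:(0,2R_1]\times(0,2R_1]\to(0,+\infty)$ such that for all $(r_1,r_2)$ every $r_1$-separated subset (distinct points at mutual distance at least $r_1$) of any closed ball of radius $r_2$ in $X$ contains at most $C(r_1,r_2)$ elements; such a function $C$ is fixed. A compact metric group $G$ carries a (compatible) metric $d_G$ and the Haar measure $\mu_G$ normalized by $\mu_G(G)=1$. For $\kappa_1,\kappa_2\geq0$, $\operatorname{Sep}(G;\kappa_1,\kappa_2)$ is the supremum of $d_G(A,B)=\inf_{a\in A,b\in B}d_G(a,b)$ over Borel subsets $A,B\subseteq G$ with $\mu_G(A)\geq\kappa_1$, $\mu_G(B)\geq\kappa_2$. For the action of $G$ on $X$, $\rho(\eta)\in[0,\infty]$ is the supremum of $d_X(gy,gz)$ over all $g\in G$ and $y,z\in X$ with $d_X(y,z)\leq\eta$; $\omega_x(\eta)\in[0,\infty]$ is the supremum of $d_X(gx,g'x)$ over all $g,g'\in G$ with $d_G(g,g')\leq\eta$; $\omega_x(+\eta):=\lim_{\eta'\downarrow\eta}\omega_x(\eta')$ for $\eta\geq 0$. $Gx$ is the orbit of $x$. *)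

(* Defs.v *)
From HB Require Import structures.
From mathcomp Require Import all_boot all_order all_algebra finmap.
From mathcomp Require Import all_classical all_reals all_analysis.

Set Implicit Arguments.
Unset Strict Implicit.
Unset Printing Implicit Defensive.

Import Order.TTheory GRing.Theory Num.Theory.
Import numFieldNormedType.Exports.

Local Open Scope classical_set_scope.
Local Open Scope ring_scope.

(* [Complete] and the measurable structure on the Borel sets both require a
   [pointedType]; the distinguished point carries no further assumption. *)
HB.structure Definition PointedMetric (R : numDomainType) :=
  {X of Pointed X & Metric R X}.

#[short(type="completeMetricType")]
HB.structure Definition CompleteMetric (R : numDomainType) :=
  {X of Complete X & PointedMetric R X}.

HB.structure Definition PreTopologicalGroup := {G of Topological G & Group G}.

HB.mixin Record PreTopologicalGroup_isTopologicalGroup G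
    & PreTopologicalGroup G := {
  mulg_continuous : continuous (fun p : G * G => (p.1 * p.2)%g) ;
  invg_continuous : continuous (fun g : G => g^-1%g)
}.

HB.structure Definition TopologicalGroup :=
  {G of PreTopologicalGroup G & PreTopologicalGroup_isTopologicalGroup G}.

#[short(type="metricGroupType")]
HB.structure Definition MetricGroup (R : numDomainType) :=
  {G of TopologicalGroup G & PointedMetric R G}.

Notation borel T := (g_sigma_algebraType (@open T)).

Section doubling.
Context {R : realType} {X : metricType R}.

(* In a metric space this can be strictly larger than the library's
   [closed_ball], which is the closure of the open ball. *)
Definition cball (x : X) (r : R) : set X := [set y | mdist x y <= r].

Definition separated (r : R) (A : set X) : Prop :=
  forall y z, A y -> A z -> y != z -> r <= mdist y z.

Definition packing_function (R1 : R) (C : R -> R -> R) : Prop :=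
  forall r1 r2, 0 < r1 <= 2 * R1 -> 0 < r2 <= 2 * R1 ->
    0 < C r1 r2 /\
    forall (x : X) (A : set X), A `<=` cball x r2 -> separated r1 A ->
      finite_set A /\ (#|` fset_set A|)%:R <= C r1 r2.

End doubling.
Arguments packing_function {R} X R1 C.

Definition doubling_space (R : realType) (X : completeMetricType R) : Prop :=
  exists2 R1 : R, 0 < R1 &
  exists D : R -> R, forall r1, 0 < r1 <= R1 ->
    0 < D r1 /\
    forall x : X, exists2 s : seq X, (size s)%:R <= D r1 &
      cball x (2 * r1) `<=` \bigcup_(y in [set` s]) cball y r1.

Section separation.
Context {R : realType} {G : metricGroupType R}.
Implicit Type mu : set (borel G) -> \bar R.

(* On a compact group, left invariance and total mass 1 determine the Borel
   measure, which is then also right-invariant. *)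
Definition haar_invariant mu : Prop :=
  forall (g : G) (A : set (borel G)), measurable A ->
    mu [set (g * h)%g | h in (A : set G)] = mu A.

Definition set_dist (A B : set G) : \bar R :=
  ereal_inf [set r | exists2 a, A a & exists2 b, B b & r = (mdist a b)%:E].

Definition Sep mu (k1 k2 : R) : \bar R :=
  ereal_sup [set r | exists A B : set (borel G),
    [/\ measurable A, measurable B, (k1%:E <= mu A)%E, (k2%:E <= mu B)%E
      & r = set_dist A B]].

End separation.
Arguments Sep {R G} mu (k1 k2)%_ring_scope.

Section action.
Context {R : realType} {G : metricGroupType R} {X : metricType R}.
Variable act : G -> X -> X.

Definition continuous_action : Prop :=
  [/\ forall x, act 1%g x = x,
      forall g h x, act (g * h)%g x = act g (act h x)
    & continuous (fun p : G * X => act p.1 p.2)].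

Definition orbit_of (x : X) : set X := [set act g x | g in [set: G]].

Definition rho (eta : R) : \bar R :=
  ereal_sup [set r | exists g y z,
    mdist y z <= eta /\ r = (mdist (act g y) (act g z))%:E].

Definition omega (x : X) (eta : R) : \bar R :=
  ereal_sup [set r | exists g g',
    mdist g g' <= eta /\ r = (mdist (act g x) (act g' x))%:E].

Definition omega_plus (x : X) (eta : R) : \bar R :=
  lim (omega x e @[e --> eta^'+]).

End action.
Arguments rho {R G X} act eta%_ring_scope.
Arguments omega {R G X} act x eta%_ring_scope.
Arguments omega_plus {R G X} act x eta%_ring_scope.

(* Main.v *)
Require Import Defs.
From HB Require Import structures.
From mathcomp Require Import all_boot all_order all_algebra finmap.
From mathcomp Require Import all_classical all_reals all_analysis.
From mathcomp Require Import lra.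

Set Implicit Arguments.
Unset Strict Implicit.
Unset Printing Implicit Defensive.

Import Order.TTheory GRing.Theory Num.Theory.
Import numFieldNormedType.Exports.

Local Open Scope classical_set_scope.
Local Open Scope ring_scope.

(* Push the Haar measure to the orbit of x. It suffices to find a closed ball
   B(z, 3 r0) of measure > 1 - kappa > 1/2: by invariance B and g B then meet,
   which bounds d(z, g z), and z' is any orbit point in B.

   Take a finite r0-separated r0-net of the compact orbit. Each net point has at
   most C(r0, 5 r0) net points within 5 r0, so the net can be coloured with at
   most C(r0, 5 r0) colours such that points of one colour are more than 5 r0
   apart. The r0-balls around one of the colours carry measure >= 1/C(r0, 5 r0),
   so by the first concentration hypothesis the 2 r0-balls around the same points
   carry measure > 1 - kappa. If one of these balls has measure >= (1 - kappa)/3,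
   the third hypothesis makes the concentric 3 r0-ball as large as required.
   Otherwise they split into two groups of measure >= (1 - kappa)/3 each, at
   mutual distance > r0, contradicting the second hypothesis. *)

(** * Greedy colouring of a finite graph *)

(** The list is coloured from its tail. By [e_refl] the new head counts itself, so its neighbours in
    the tail number fewer than [N] and some colour below [N] is free. *)
Lemma greedy_coloring (T : eqType) (e : rel T) (N : nat) (s : seq T) :
    reflexive e -> symmetric e -> uniq s ->
    (forall p, p \in s -> (count (e p) s <= N)%N) ->
  exists2 c : T -> nat, (forall p, p \in s -> (c p < N)%N) &
    {in s &, forall p q, p != q -> e p q -> c p != c q}.
Proof.
move=> e_refl e_sym; elim: s => [_ _|p s IHs]; first by exists (fun=> 0%N).
move=> /= /andP[p_s uniq_s] degN.
have [q qs|c cN c_proper] := IHs uniq_s.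
  have := degN q; rewrite inE qs orbT /= => /(_ isT).
  by apply: leq_trans; exact: leq_addl.
have used_lt : (size [seq c q | q <- s & e p q] < N)%N.
  by rewrite size_map size_filter; have := degN p (mem_head _ _); rewrite e_refl.
have /hasP[k + k_free] : has [predC [seq c q | q <- s & e p q]] (iota 0 N).
  rewrite has_predC; apply: contraL used_lt => /allP used.
  by rewrite -leqNgt -[X in (X <= _)%N](size_iota 0) uniq_leq_size// iota_uniq.
rewrite mem_iota add0n => /= kN.
exists (fun q => if q == p then k else c q) => [q|q1 q2].
  by rewrite inE; case: eqP => //= _; exact: cN.
have neigh q : q \in s -> e p q -> k != c q.
  move=> qs epq; apply: contraNneq k_free => ->.
  by rewrite map_f// mem_filter epq.
rewrite !inE; case: (eqVneq q1 p) => [->|q1p] /=; case: (eqVneq q2 p) => [->|q2p] //=.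
- by move=> _ qs _; exact: neigh.
- by move=> qs _ _; rewrite e_sym eq_sym; exact: neigh.
- exact: c_proper.
Qed.

(** * Nets, closed balls and packing in a metric space *)

Section metric.
Context {R : realType} {X : PointedMetric.type R}.
Implicit Types (A : set X) (r : R) (x y z : X).

Lemma compact_finite_net A r : 0 < r -> compact A ->
  exists t : seq X, forall y, A y -> exists2 z, z \in t & mdist z y < r.
Proof.
move=> r0; rewrite (@compact_cover X) => /(_ X setT (fun z => (ball z r)°)).
case=> [z _|y Ay|D _ AD]; first exact: open_interior.
- by exists y => //; exact: nbhsx_ballx.
- exists (enum_fset D) => y /AD[z /= zD /interior_subset zy].
  by exists z => //; move: zy; rewrite ballEmdist.
Qed.

(* Running through an [r/2]-net [t] of [A], the ball around the next point of
   [t] is either already [r]-covered or [r]-covered by any uncovered point. *)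
Lemma separated_net A r : 0 < r -> compact A ->
  exists s : seq X, [/\ uniq s, Defs.separated r [set` s] &
    forall y, A y -> exists2 z, z \in s & mdist z y < r].
Proof.
move=> r0 /(@compact_finite_net _ (r / 2))[|t tA]; first lra.
(* The induction on [t] needs a claim without [A]: the points to cover are those within [r / 2] of
   [t]. *)
suff [s [uniq_s sep_s ts]] : exists s : seq X, [/\ uniq s, Defs.separated r [set` s] &
    forall y, (exists2 z, z \in t & mdist z y < r / 2) ->
      exists2 z, z \in s & mdist z y < r].
  by exists s; split => // y /tA; exact: ts.
elim: t {tA} => [|p t [s [uniq_s sep_s ts]]].
  by exists [::]; split => // y [z].
have [cov|/existsNP[q /not_implyP[pq /forall2NP q_far]]] := pselect (forall y,
    mdist p y < r / 2 -> exists2 z, z \in s & mdist z y < r).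
  exists s; split => // y [z]; rewrite inE => /predU1P[->|zt zy]; first exact: cov.
  by apply: ts; exists z.
have qs z : z \in s -> r <= mdist z q.
  by move=> zs; have [//|/negP] := q_far z; rewrite -leNgt.
exists (q :: s); split.
- rewrite /= uniq_s andbT; apply/negP => /qs; rewrite mdistxx; lra.
- move=> y z /=; rewrite !inE => /predU1P[->|ys] /predU1P[->|zs].
  + by rewrite eqxx.
  + by move=> _; rewrite metric_sym; exact: qs.
  + by move=> _; exact: qs.
  + exact: sep_s.
- move=> y [z]; rewrite inE => /predU1P[->|zt zy].
    move=> py; exists q; rewrite ?mem_head//.
    have := metric_triangle q p y; rewrite (metric_sym q p); lra.
  have [|w ws wy] := ts y; first by exists z.
  by exists w => //; rewrite inE ws orbT.
Qed.

Lemma compact_mdist_bounded A x : compact A ->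
  exists M : R, forall y, A y -> mdist x y <= M.
Proof.
move=> /(@compact_finite_net _ 1)[//|t tA].
exists (\big[Num.max/0]_(z <- t) mdist x z + 1) => y /tA[z zt zy].
have := metric_triangle x z y.
have : mdist x z <= \big[Num.max/0]_(z <- t) mdist x z by exact: le_bigmax_seq.
lra.
Qed.

Lemma closed_cball x r : closed (cball x r).
Proof.
rewrite -openC openE => y /= /negP; rewrite -ltNge => rxy.
apply/nbhs_ballP; exists (mdist x y - r) => /=; first lra.
rewrite ballEmdist => z /= yz; apply/negP; rewrite -ltNge.
have := metric_triangle x z y; rewrite (metric_sym z y); lra.
Qed.

(** Colours are counted by naturals, hence the truncation: a count above it is at least the
    truncation plus one, which exceeds the real bound. *)
Lemma packing_count R1 C r1 r2 (s : seq X) p :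
    packing_function X R1 C -> 0 < r1 <= 2 * R1 -> 0 < r2 <= 2 * R1 ->
    uniq s -> Defs.separated r1 [set` s] ->
  (count (fun q => (mdist p q <= r2)%R) s <= Num.truncn (C r1 r2))%N.
Proof.
move=> packC r1R r2R uniq_s sep_s; have [C0 /(_ p)packed] := packC _ _ r1R r2R.
pose t := [seq q <- s | mdist p q <= r2].
have [||fin_t] := packed [set` t].
- by move=> y /=; rewrite mem_filter => /andP[].
- by move=> y z /=; rewrite !mem_filter => /andP[_ ys] /andP[_ zs]; exact: sep_s.
apply: contraTT; rewrite -ltnNge -ltNge => Clt.
rewrite -size_filter -/t in Clt.
have : (size t <= #|` fset_set [set` t]|)%N.
  apply: uniq_leq_size; first exact: filter_uniq.
  by move=> y yt; rewrite in_fset_set// inE.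
move=> /(leq_trans Clt); rewrite -(ler_nat R).
by apply: lt_le_trans; exact: truncnS_gt.
Qed.

End metric.

(** * Separation distance and modulus of the orbit map *)

Section separation.
Context {R : realType} {G : metricGroupType R}.
Implicit Types A B : set (borel G).

Lemma set_dist_ge0 A B : (0 <= set_dist A B)%E.
Proof.
by apply: le_ereal_inf_tmp => _ [a _ [b _ ->]]; rewrite lee_fin mdist_ge0.
Qed.

Lemma set_dist_le A B a b : A a -> B b -> (set_dist A B <= (mdist (a : G) b)%:E)%E.
Proof. by move=> Aa Bb; apply: ereal_inf_lbound; exists a => //; exists b. Qed.

Lemma omega_nondecreasing (X : metricType R) (act : G -> X -> X) (x : X) :
  {homo omega act x : e1 e2 / e1 <= e2 >-> (e1 <= e2)%E}.
Proof.
move=> e1 e2 e12; apply: ereal_sup_le => _ [g [g' [gg' ->]]].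
by exists g, g'; split => //; exact: le_trans e12.
Qed.

(** By monotonicity the right limit is the infimum of [omega] over [e > eta]. The room between [eta]
    and [e] is needed because the infimum in [set_dist] may not be attained. *)
Lemma omega_plus_lt (X : metricType R) (act : G -> X -> X) (x : X)
    (eta : R) (l : \bar R) :
  (omega_plus act x eta < l)%E -> exists2 e, eta < e & (omega act x e < l)%E.
Proof.
rewrite /omega_plus.
have /cvg_lim -> // := @nondecreasing_at_right_cvge _ (omega act x) eta (BInfty _ false)
  erefl (in2W (@omega_nondecreasing X act x)).
by move=> /ereal_inf_lt[_ [e + <-]] el; rewrite /= in_itv /= andbT => etae; exists e.
Qed.

(** Sets of positive measure are nonempty, so their distance is at most twice a bound on the
    distances to [point]. *)
Lemma Sep_fineK (mu : probability (borel G) R) (k1 k2 : R) A B :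
    compact [set: G] -> 0 < k1 -> 0 < k2 ->
    measurable A -> measurable B -> (k1%:E <= mu A)%E -> (k2%:E <= mu B)%E ->
  ((fine (Sep mu k1 k2))%:E = Sep mu k1 k2)%E.
Proof.
move=> compactG k1_gt0 k2_gt0 mA mB kA kB.
have [M bndM] := compact_mdist_bounded point compactG.
have nonempty k D : 0 < k -> (k%:E <= mu D)%E -> exists d, D d.
  move=> k0; have [->|/set0P//] := eqVneq D set0.
  by rewrite measure0 lee_fin leNgt k0.
rewrite fineK// ge0_fin_numE.
  apply: (@le_lt_trans _ _ (M + M)%:E); last exact: ltry.
  apply: ge_ereal_sup => _ [D [E [_ _ kD kE ->]]].
  have [d Dd] := nonempty _ _ k1_gt0 kD; have [e Ee] := nonempty _ _ k2_gt0 kE.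
  apply: (le_trans (set_dist_le Dd Ee)).
  rewrite lee_fin (le_trans (metric_triangle _ point _))// lerD ?bndM//.
  by rewrite metric_sym bndM.
(* The pair [A], [B] keeps the supremum from being taken over the empty set, where it would be
   [-oo]. *)
apply: (le_trans (set_dist_ge0 A B)).
by apply: ereal_sup_ubound; exists A, B.
Qed.

(** The form in which each concentration hypothesis is applied: [set_dist A B <= Sep < e] yields
    [a], [b] closer than [e], and [omega] at [e] is still below [r]. *)
Lemma concentrated_orbit_map (mu : probability (borel G) R) (X : metricType R)
    (act : G -> X -> X) (x : X) (k1 k2 r : R) A B :
    compact [set: G] -> 0 < k1 -> 0 < k2 ->
    (omega_plus act x (fine (Sep mu k1 k2)) < r%:E)%E ->
    measurable A -> measurable B -> (k1%:E <= mu A)%E -> (k2%:E <= mu B)%E ->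
  exists a b, [/\ A a, B b & mdist (act a x) (act b x) < r].
Proof.
move=> compactG k1_gt0 k2_gt0 /omega_plus_lt[e Sep_e omega_r] mA mB kA kB.
have : (set_dist A B < e%:E)%E.
  apply: (@le_lt_trans _ _ (Sep mu k1 k2)).
    by apply: ereal_sup_ubound; exists A, B.
  by rewrite -(Sep_fineK compactG k1_gt0 k2_gt0 mA mB kA kB) lte_fin.
move=> /ereal_inf_lt[_ [a Aa [b Bb ->]]]; rewrite lte_fin => abe.
exists a, b; split => //; rewrite -lte_fin; apply: le_lt_trans omega_r.
by apply: ereal_sup_ubound; exists a, b; split => //; exact: ltW.
Qed.

End separation.

(** * Splitting mass in a probability space *)

Section probability.
Context d (T : measurableType d) {R : realType} (P : probability T R).

Lemma probability_pigeonhole (N : nat) (F : nat -> set T) :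
    (forall i, measurable (F i)) -> (forall x, exists2 i, (i < N)%N & F i x) ->
  exists2 i, (i < N)%N & ((N%:R^-1)%:E <= P (F i))%E.
Proof.
move=> mF covF; apply: contrapT => noF.
have lt_F (i : 'I_N) : fine (P (F i)) < N%:R^-1.
  rewrite -lte_fin fineK ?fin_num_measure//; rewrite ltNge; apply/negP => Fi.
  by apply: noF; exists i.
have : (P [set: T] <= \sum_(i < N) P (F i))%E.
  apply: content_subadditive => // x _; rewrite -bigcup_mkord.
  by have [i iN Fix] := covF x; exists i.
rewrite probability_setT; apply/negP; rewrite -ltNge.
under eq_bigr do rewrite -[P _]fineK ?fin_num_measure//.
rewrite sumEFin lte_fin.
(* Strict comparison of the sums needs an index, so [N = 0], where the sum is empty, is treated
   apart. *)
case: N covF noF lt_F => [|N] covF noF lt_F; first by rewrite big_ord0.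
apply: (@lt_le_trans _ _ (\sum_(i < N.+1) N.+1%:R^-1)).
  by apply: ltr_sum => //; apply/hasP; exists ord0; rewrite ?mem_index_enum.
by rewrite sumr_const card_ord -[leLHS]mulr_natr mulVf ?pnatr_eq0.
Qed.

(** Take the shortest prefix of mass at least [t]: without its last set the mass is below [t], and
    that set adds less than [t]. *)
Lemma probability_prefix (I : eqType) (F : I -> set T) (t : R) (s : seq I) :
    (forall i, measurable (F i)) -> 0 < t ->
    (forall i, i \in s -> (P (F i) < t%:E)%E) ->
    (t%:E <= P (\bigcup_(i in [set` s]) F i))%E ->
  exists s1 s2, [/\ s = s1 ++ s2, (t%:E <= P (\bigcup_(i in [set` s1]) F i))%E &
    (P (\bigcup_(i in [set` s1]) F i) <= (2 * t)%:E)%E].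
Proof.
move=> mF t0; have mU (u : seq I) : measurable (\bigcup_(i in [set` u]) F i).
  by apply: fin_bigcup_measurable => // i _; exact: mF.
elim/last_ind: s => [|s i IHs] smallF.
  by rewrite bigcup0// measure0 lee_fin leNgt t0.
have [ts _|ts_lt ti] := leP t%:E (P (\bigcup_(i in [set` s]) F i)).
  have [|//|s1 [s2 [-> ts1 s1t]]] := IHs.
    by move=> j js; apply: smallF; rewrite mem_rcons inE js orbT.
  by exists s1, (rcons s2 i); rewrite rcons_cat.
exists (rcons s i), [::]; rewrite cats0; split => //.
apply: (@le_trans _ _ (P (\bigcup_(i in [set` s]) F i) + P (F i))%E).
  apply: le_trans (measureU2 _ _ _) => //; apply: le_measure; rewrite ?inE//.
    exact: measurableU.
  move=> y [j /=]; rewrite mem_rcons inE => /predU1P[->|js] Fy; first by right.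
  by left; exists j.
rewrite mulr_natl mulr2n EFinD; apply: leeD; apply: ltW => //.
by apply: smallF; rewrite mem_rcons mem_head.
Qed.

End probability.

(** * Mass of balls along the orbit *)

Section orbit.
Context {R : realType} {G : metricGroupType R} {X : completeMetricType R}.
Context (act : G -> X -> X) (act_cont : continuous_action act) (x : X).

(** Its measure is the mass of the closed ball under the push-forward of the Haar measure to the
    orbit. *)
Definition orbit_preimage (z : X) (r : R) : set (borel G) :=
  [set g | mdist z (act g x) <= r].

(** The factor [h] serves to show that translates of [orbit_preimage] are closed, hence
    measurable. *)
Lemma continuous_orbit_map (h : G) : continuous (fun g : G => act (h * g)%g x).
Proof.
have [_ actM act_continuous] := act_cont => g.
have -> : (fun g : G => act (h * g)%g x) = (fun g => act h (act g x)).
  by apply/funext => g'; rewrite actM.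
apply: (@continuous2_cvg _ _ _ _ _ _ (fun=> h) (fun g' => act g' x) act h (act g x)).
- exact: (act_continuous (h, act g x)).
- exact: cvg_cst.
- apply: (@continuous2_cvg _ _ _ _ _ _ id (fun=> x) act g x).
  + exact: (act_continuous (g, x)).
  + exact: cvg_id.
  + exact: cvg_cst.
Qed.

Lemma measurable_orbit_preimage z r : measurable (orbit_preimage z r).
Proof.
rewrite -[orbit_preimage z r]setCK; apply: measurableC.
apply: sub_sigma_algebra; rewrite /= openC.
have -> : orbit_preimage z r = (fun g : G => act (1 * g)%g x) @^-1` cball z r.
  by apply/seteqP; split => g; rewrite /orbit_preimage /cball /= mul1g.
apply: preimage_closed; last exact: closed_cball.
by move=> g _; exact: continuous_orbit_map.
Qed.

Lemma translate_orbit_preimage (h : G) z r :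
  [set (h * g)%g | g in (orbit_preimage z r : set G)] =
  (fun g : G => act (h^-1 * g)%g x) @^-1` cball z r.
Proof.
apply/seteqP; split => g; rewrite /orbit_preimage /cball /=.
  by move=> [g' + <-]; rewrite mulKg.
by move=> gz; exists (h^-1 * g)%g => //; exact: mulVKg.
Qed.

Lemma compact_orbit : compact [set: G] -> compact (orbit_of act x).
Proof.
have -> : orbit_of act x = (fun g : G => act (1 * g)%g x) @` [set: G].
  by apply/seteqP; split => _ [g _ <-]; exists g; rewrite ?mul1g.
by apply: continuous_compact; apply: continuous_subspaceT; exact: continuous_orbit_map.
Qed.

(** The set and its [h]-translate both have mass above 1/2, so they cannot be disjoint. *)
Lemma translate_meets_orbit_preimage (mu : probability (borel G) R) z r (h : G) :
    haar_invariant mu -> ((1 / 2)%:E < mu (orbit_preimage z r))%E ->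
  exists g, mdist z (act g x) <= r /\ mdist z (act (h * g)%g x) <= r.
Proof.
move=> haar_mu half_lt; set E := orbit_preimage z r.
have mE : measurable E by exact: measurable_orbit_preimage.
pose hE : set (borel G) := [set (h * g)%g | g in (E : set G)].
have mhE : measurable hE.
  rewrite /hE translate_orbit_preimage.
  rewrite -[X in measurable X]setCK; apply: measurableC.
  apply: sub_sigma_algebra; rewrite /= openC.
  by apply: preimage_closed => [g _|]; [exact: continuous_orbit_map|exact: closed_cball].
have [disj|/set0P[g [Eg [g' Eg' hg'E]]]] := eqVneq (E `&` hE) set0; last first.
  by exists g'; split => //; rewrite hg'E.
have : (mu (E `|` hE) <= 1)%E by apply: probability_le1; exact: measurableU.
have hE_E : mu hE = mu E by exact: haar_mu.
have -> : (mu (E `|` hE) = mu E + mu hE)%E by exact: measureU.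
rewrite hE_E.
move: half_lt; rewrite -/E -[mu E]fineK ?fin_num_measure// -EFinD lte_fin lee_fin; lra.
Qed.

(** Go from [z] to [act (h * g) x] inside the ball, then to [act h z]: the second leg is the
    [h]-image of a leg of length at most [r]. *)
Lemma concentrated_displacement (mu : probability (borel G) R) z r (h : G) :
    haar_invariant mu -> ((1 / 2)%:E < mu (orbit_preimage z r))%E ->
  ((mdist z (act h z))%:E <= r%:E + rho act r)%E.
Proof.
move=> haar_mu half_lt.
have [g [gz hgz]] := translate_meets_orbit_preimage h haar_mu half_lt.
have [_ actM _] := act_cont.
apply: (@le_trans _ _ (r%:E + (mdist (act h (act g x)) (act h z))%:E)%E).
  rewrite -EFinD lee_fin (le_trans (metric_triangle _ (act (h * g)%g x) _))//.
  by rewrite actM lerD2r -actM.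
rewrite leeD2l//; apply: ereal_sup_ubound; exists h, (act g x), z; split => //.
by rewrite metric_sym.
Qed.

End orbit.

(** * A ball of mass above [1 - kappa] *)

Section concentration.
Context {R : realType} {G : metricGroupType R} {X : completeMetricType R}.
Context (act : G -> X -> X) (act_cont : continuous_action act) (x : X).

Lemma concentrated_ball (mu : probability (borel G) R) (R1 : R)
    (C : R -> R -> R) (r0 kappa : R) :
    compact [set: G] -> packing_function X R1 C ->
    0 < r0 -> 5 * r0 <= 2 * R1 -> 0 < kappa < 1 ->
    (omega_plus act x (fine (Sep mu kappa (1 / C r0 (5 * r0))%R)) < r0%:E)%E ->
    (omega_plus act x (fine (Sep mu ((1 - kappa) / 3) ((1 - kappa) / 3))) < r0%:E)%E ->
    (omega_plus act x (fine (Sep mu ((1 - kappa) / 3) kappa)) < r0%:E)%E ->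
  exists z, ((1 - kappa)%:E < mu (orbit_preimage act x z (3 * r0)%R))%E.
Proof.
move=> compactG packC r0_gt0 r0_dom /andP[kappa_gt0 kappa_lt1].
move=> Sep_pack Sep_third Sep_kappa.
set E := orbit_preimage act x.
have mE z r : measurable (E z r) by exact: measurable_orbit_preimage.
have mU (u : seq X) r : measurable (\bigcup_(z in [set` u]) E z r).
  by apply: fin_bigcup_measurable => // z _; exact: mE.
have tri := metric_triangle; have sym := metric_sym.
have third_gt0 : 0 < (1 - kappa) / 3 by lra.
have r0R : 0 < r0 <= 2 * R1 by lra.
have r5R : 0 < 5 * r0 <= 2 * R1 by lra.
have C_gt0 : 0 < C r0 (5 * r0) by have [] := packC _ _ r0R r5R.
have large D : measurable D -> ~ (kappa%:E <= mu (~` D))%E -> ((1 - kappa)%:E < mu D)%E.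
  move=> mD /negP; rewrite -ltNge probability_setC//.
  rewrite -[mu D]fineK ?fin_num_measure// -EFinB !lte_fin; lra.
have [s [uniq_s sep_s net_s]] :=
  separated_net r0_gt0 (compact_orbit (x := x) act_cont compactG).
set N := Num.truncn (C r0 (5 * r0)).
(* The factor 5 is 2 + 1 + 2: two balls of radius [2 * r0] and a gap of [r0] between them. *)
pose near_rel : rel X := fun p q => mdist p q <= 5 * r0.
have near_refl : reflexive near_rel by move=> p; rewrite /near_rel mdistxx; lra.
have near_sym : symmetric near_rel by move=> p q; rewrite /near_rel metric_sym.
have near_deg p : p \in s -> (count (near_rel p) s <= N)%N.
  by move=> _; exact: packing_count packC r0R r5R uniq_s sep_s.
have [c c_lt c_proper] := greedy_coloring near_refl near_sym uniq_s near_deg.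
pose Z i := [seq z <- s | c z == i].
have [||i iN Zi_large] := @probability_pigeonhole _ _ _ mu N
    (fun i => \bigcup_(z in [set` Z i]) E z r0).
- by move=> i; exact: mU.
- move=> g; have [|z zs zg] := net_s (act g x); first by exists g.
  exists (c z); first exact: c_lt.
  by exists z; [rewrite /= mem_filter eqxx|exact: ltW].
have Zi_far z1 z2 : z1 \in Z i -> z2 \in Z i -> z1 != z2 -> 5 * r0 < mdist z1 z2.
  rewrite !mem_filter => /andP[/eqP cz1 z1s] /andP[/eqP cz2 z2s] z12.
  rewrite ltNge; apply/negP => /(c_proper _ _ z1s z2s z12).
  by rewrite cz1 cz2 eqxx.
(* Otherwise the complement has mass at least [kappa], so one of its points maps within [r0] of a
   ball of radius [r0], hence into the union. *)
have islands : ((1 - kappa)%:E < mu (\bigcup_(z in [set` Z i]) E z (2 * r0)%R))%E.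
  apply: (large _ (mU _ _)) => W_large.
  have [||a [b [aW [z Zz zb] ab]]] := concentrated_orbit_map compactG kappa_gt0
      _ Sep_pack (measurableC (mU _ _)) (mU (Z i) r0) W_large.
  - by rewrite divr_gt0.
  (* [N] is positive because [i < N], and it is at most [C r0 (5 * r0)]. *)
  - apply: le_trans Zi_large; rewrite lee_fin div1r lef_pV2 ?posrE ?ltr0n//.
      by rewrite truncn_le ltW.
    exact: leq_ltn_trans iN.
  - apply: aW; exists z => //; rewrite /E /orbit_preimage /=.
    move: zb; rewrite /E /orbit_preimage /=.
    have := tri _ X z (act b x) (act a x); rewrite (sym _ X (act b x)); lra.
have [[z Zz z_large]|no_large] :=
    pselect (exists2 z, z \in Z i & (((1 - kappa) / 3)%:E <= mu (E z (2 * r0)%R))%E).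
  exists z; apply: (large _ (mE _ _)) => compl_large.
  have [a [b [za zb ab]]] := concentrated_orbit_map compactG third_gt0 kappa_gt0 Sep_kappa
    (mE _ _) (measurableC (mE _ _)) z_large compl_large.
  apply: zb; move: za; rewrite /E /orbit_preimage /=.
  have := tri _ X z (act a x) (act b x); lra.
exfalso.
have [||||s1 [s2 [s12 s1_large s1_small]]] :=
  @probability_prefix _ _ _ mu _ (E^~ (2 * r0))
    ((1 - kappa) / 3) (Z i).
- by move=> z; exact: mE.
- by [].
- by move=> z Zz; rewrite ltNge; apply/negP => z_large; apply: no_large; exists z.
- by apply: le_trans (ltW islands); rewrite lee_fin; lra.
(* The total exceeds [1 - kappa], and [s1] takes at most two thirds of that. *)
have s2_large : (((1 - kappa) / 3)%:E <= mu (\bigcup_(z in [set` s2]) E z (2 * r0)%R))%E.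
  have : (mu (\bigcup_(z in [set` Z i]) E z (2 * r0)%R) <=
      mu (\bigcup_(z in [set` s1]) E z (2 * r0)%R) +
      mu (\bigcup_(z in [set` s2]) E z (2 * r0)%R))%E.
    apply: le_trans (measureU2 _ _ _) => //; apply: le_measure; rewrite ?inE//.
      exact: measurableU.
    move=> g [z /=]; rewrite s12 mem_cat => /orP[zs|zs] gz; [left|right]; by exists z.
  move: islands s1_small.
  have fin_mu (u : seq X) : exists w : R,
      mu (\bigcup_(z in [set` u]) E z (2 * r0)%R) = w%:E.
    exists (fine (mu (\bigcup_(z in [set` u]) E z (2 * r0)%R))); apply/esym/fineK.
    by apply: fin_num_measure; exact: mU.
  have [w ->] := fin_mu (Z i); have [w1 ->] := fin_mu s1; have [w2 ->] := fin_mu s2.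
  rewrite -EFinD lte_fin !lee_fin; lra.
have [a [b [[z1 z1s z1a] [z2 z2s z2b] ab]]] := concentrated_orbit_map compactG third_gt0
  third_gt0 Sep_third (mU _ _) (mU _ _) s1_large s2_large.
(* [Z i] has no repetitions, so [s1] and [s2] share no centre. *)
have z12 : z1 != z2.
  have : uniq (Z i) by exact: filter_uniq.
  rewrite s12 cat_uniq => /and3P[_ /hasPn s12_disj _].
  by apply: contraTneq z1s => ->; exact: s12_disj.
have := Zi_far z1 z2; rewrite s12 !mem_cat z1s z2s orbT => /(_ isT isT z12).
move: z1a z2b; rewrite /E /orbit_preimage /=.
have := tri _ X z1 (act a x) z2; have := tri _ X (act a x) (act b x) z2.
rewrite (sym _ X (act b x)); lra.
Qed.

End concentration.

(* [Sep mu k1 k2] is finite for k1, k2 > 0 since G is compact, so that [fine]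
   only casts it from extended reals to reals. *)
Theorem proposition3p16 (R : realType)
  (G : metricGroupType R) (compactG : compact [set: G])
  (mu : probability (borel G) R) (haar_mu : haar_invariant mu)
  (X : completeMetricType R) (doublingX : doubling_space X)
  (R1 : R) (R1_gt0 : 0 < R1)
  (C : R -> R -> R) (packC : packing_function X R1 C)
  (act : G -> X -> X) (act_cont : continuous_action act)
  (x : X) (r0 : R) (r0_gt0 : 0 < r0) (r0_dom : 5 * r0 <= 2 * R1)
  (kappa : R) (kappa_itv : 0 < kappa < 1 / 2)
  (r0_large :
    (maxe (omega_plus act x (fine (Sep mu kappa (1 / C r0 (5 * r0))%R)))
      (maxe (omega_plus act x (fine (Sep mu ((1 - kappa) / 3) ((1 - kappa) / 3))))
            (omega_plus act x (fine (Sep mu ((1 - kappa) / 3) kappa))))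
     < r0%:E)%E) :
  (exists z : X, forall g : G,
     ((mdist z (act g z))%:E <= (3 * r0)%:E + rho act (3 * r0))%E) /\
  (exists2 z' : X, orbit_of act x z' & forall g : G,
     ((mdist z' (act g z'))%:E <=
        mine ((6 * r0)%:E + rho act (6 * r0))
             ((6 * r0)%:E + 2%:E * rho act (3 * r0)))%E).
Proof.
move: r0_large; rewrite !gt_max => /and3P[Sep_pack Sep_third Sep_kappa].
have [|z z_large] := concentrated_ball act_cont compactG packC r0_gt0 r0_dom _
  Sep_pack Sep_third Sep_kappa; first lra.
(* Used for [z] with radius [3 * r0] and for the orbit point with radius [6 * r0]. *)
have half_lt r (w : X) : (forall y, mdist z y <= 3 * r0 -> mdist w y <= r) ->
    ((1 / 2)%:E < mu (orbit_preimage act x w r))%E.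
  move=> zw; apply: (@lt_le_trans _ _ (mu (orbit_preimage act x z (3 * r0)))).
    by apply: lt_trans z_large; rewrite lte_fin; lra.
  apply: le_measure; rewrite ?inE; try exact: measurable_orbit_preimage.
  by move=> g; exact: zw.
have z_disp g : ((mdist z (act g z))%:E <= (3 * r0)%:E + rho act (3 * r0))%E.
  by apply: (concentrated_displacement act_cont _ haar_mu); exact: half_lt.
split; first by exists z.
(* The translation by 1 only serves to extract an orbit point in the ball. *)
have [g0 [zg0 _]] := translate_meets_orbit_preimage act_cont 1%g haar_mu
  (half_lt (3 * r0) z (fun _ => id)).
exists (act g0 x); first by exists g0.
move=> g; rewrite le_min; apply/andP; split.
  apply: (concentrated_displacement act_cont _ haar_mu); apply: half_lt => y zy.
  have := metric_triangle (act g0 x) z y; rewrite (metric_sym _ z); lra.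
set z' := act g0 x in zg0 *.
have gz' : ((mdist (act g z) (act g z'))%:E <= rho act (3 * r0))%E.
  by apply: ereal_sup_ubound; exists g, z, z'.
(* Second bound: the route is [z'], [z], [act g z], [act g z']. *)
apply: (@le_trans _ _ ((3 * r0)%:E + ((3 * r0)%:E + rho act (3 * r0)) +
    rho act (3 * r0))%E).
  apply: (@le_trans _ _ ((mdist z' z)%:E + (mdist z (act g z))%:E +
      (mdist (act g z) (act g z'))%:E)%E).
    rewrite -!EFinD lee_fin.
    have := metric_triangle z' z (act g z').
    have := metric_triangle z (act g z) (act g z'); lra.
  by rewrite !leeD// lee_fin metric_sym.
rewrite addeA -EFinD -addeA mule_natl mule2n.
by have -> : 3 * r0 + 3 * r0 = 6 * r0 by lra.
Qed.
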